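(* There is an absolute constant $K>0$ such that the following holds. Let $C$ be an optimal $[n,k,d]_q$ linear locally repairable code with locality $r\ge 1$ (so $d = n-k-\lceil k/r\rceil + 2$), with $(r+1)\mid n$ and $$\frac{n}{r+1}\ \ge\ \left(d-2-\left\lfloor\frac{d-2}{r+1}\right\rfloor\right)(3r+2)+\left\lfloor\frac{d-2}{r+1}\right\rfloor+1 .$$ Suppose $d\ge 5$ and let $a\in\{1,2,3,4\}$ be such that $d\equiv a \pmod 4$. Then $$n\le K d\, q^{\frac{4(d-2)}{d-a}-1}\ \text{ if } a\in\{1,2\},\qquad n\le K d\, q^{\frac{4(d-3)}{d-a}-1}\ \text{ if } a\in\{3,4\}.$$ In particular, $n = O\big(d q^{3+\frac{4}{d-4}}\big)$. Furthermore, $n=O(q^2)$, $O(q^3)$, $O(q^3)$, $O(q^4)$, $O(q^{2.5})$ and $O(q^3)$ for $d=5,6,7,8,9$ and $10$, respectively (all implied constants being absolute).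
   Context: All codes are linear. An $[n,k,d]_q$ code is a linear subspace of $\mathbb{F}_q^n$ of dimension $k\ge 1$ and minimum Hamming distance $d$. For a code $C\subseteq \mathbb{F}_q^n$, an index $i\in\{1,\dots,n\}$ and $\alpha\in\mathbb{F}_q$, let $C(i,\alpha)=\{(c_1,\dots,c_n)\in C : c_i=\alpha\}$, and for $I\subseteq\{1,\dots,n\}\setminus\{i\}$ let $C_I(i,\alpha)$ be the projection of $C(i,\alpha)$ on the coordinates in $I$. A set $R\subseteq\{1,\dots,n\}$ containing $i$ is a recovery set for $i$ if $C_{R\setminus\{i\}}(i,\alpha)\cap C_{R\setminus\{i\}}(i,\beta)=\emptyset$ for all $\alpha\ne\beta$ in $\mathbb{F}_q$. The code $C$ is a locally repairable code (LRC) with locality $r$ if every $i\in\{1,\dots,n\}$ has a recovery set of size $r+1$. Every linear $[n,k,d]_q$ LRC with locality $r$ satisfies the Singleton-type bound $d\le n-k-\lceil k/r\rceil+2$; it is called optimal if equality holds. *)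

(* Defs.v *)
From mathcomp Require Import all_boot all_order all_algebra.
From mathcomp Require Import reals exp.

Set Implicit Arguments.
Unset Strict Implicit.
Unset Printing Implicit Defensive.

Import Order.TTheory GRing.Theory Num.Theory.
Local Open Scope ring_scope.

Definition hamming_dist (F : finFieldType) (n : nat) (x y : 'rV[F]_n) : nat :=
  #|[set i : 'I_n | x 0 i != y 0 i]|.

Definition min_distance (F : finFieldType) (n : nat)
    (C : {vspace 'rV[F]_n}) (d : nat) : Prop :=
  (exists x y : 'rV[F]_n,
      [/\ x \in C, y \in C, x != y & hamming_dist x y = d]) /\
  (forall x y : 'rV[F]_n,
      x \in C -> y \in C -> x != y -> (d <= hamming_dist x y)%N).

(* [n, k, d]_q code, with q = #|F| *)
Definition linear_code (F : finFieldType) (n : nat)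
    (C : {vspace 'rV[F]_n}) (k d : nat) : Prop :=
  [/\ (1 <= k)%N, \dim C = k & min_distance C d].

(* C(i, alpha) *)
Definition subcode (F : finFieldType) (n : nat)
    (C : {vspace 'rV[F]_n}) (i : 'I_n) (alpha : F) : {set 'rV[F]_n} :=
  [set c : 'rV[F]_n | (c \in C) && (c 0 i == alpha)].

Definition coord_proj (F : finFieldType) (n : nat) (I : {set 'I_n})
    (c : 'rV[F]_n) : {ffun {j : 'I_n | j \in I} -> F} :=
  [ffun j => c 0 (val j)].

(* C_I(i, alpha) *)
Definition proj_subcode (F : finFieldType) (n : nat)
    (C : {vspace 'rV[F]_n}) (I : {set 'I_n}) (i : 'I_n) (alpha : F) :
    {set {ffun {j : 'I_n | j \in I} -> F}} :=
  [set coord_proj I c | c in subcode C i alpha].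

Definition recovery_set (F : finFieldType) (n : nat)
    (C : {vspace 'rV[F]_n}) (i : 'I_n) (S : {set 'I_n}) : Prop :=
  i \in S /\
  forall alpha beta : F, alpha != beta ->
    proj_subcode C (S :\ i) i alpha :&: proj_subcode C (S :\ i) i beta = set0.

Definition has_locality (F : finFieldType) (n : nat)
    (C : {vspace 'rV[F]_n}) (r : nat) : Prop :=
  forall i : 'I_n, exists S : {set 'I_n}, recovery_set C i S /\ #|S| = r.+1.

Definition optimal_LRC (F : finFieldType) (n : nat)
    (C : {vspace 'rV[F]_n}) (k d r : nat) : Prop :=
  [/\ linear_code C k d, has_locality C r &
      d%:Z = n%:Z - k%:Z - Num.ceil (k%:Q / r%:Q) + 2].

(* All uses are with 5 <= d, so that the truncated subtractions are exact. *)
Definition length_condition (n d r : nat) : Prop :=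
  (r.+1 %| n)%N /\
  ((d - 2 - (d - 2) %/ r.+1) * (3 * r + 2) + (d - 2) %/ r.+1 + 1
     <= n %/ r.+1)%N.

(* Main.v *)
(** By locality every coordinate lies in the support of a dual word of weight
    at most r+1.  A minimal cover by l such supports gives each word h x a
    private pivot coordinate p x.  Optimality forces n - k to exceed n/(r+1)
    by at most d - 2, so l is close to n/(r+1) when n is large, the supports
    are nearly disjoint, and at least n/5 non-pivot coordinates j lie in exactly
    one of them.  For such j the unit vector corrected at one pivot has weight
    at most 2 and is orthogonal to all h x.  Combinations of e of these vectors
    have weight at most 2e, hence lie in distinct cosets of C inside the space
    orthogonal to all h x as soon as 4e < d; counting cosets is a Hamming bound,
    and since the index of C in that space is at most q^(d-2), it bounds n.
    When d = 3, 4 (mod 4) one coordinate is left arbitrary, as in puncturing,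
    which saves a factor q. *)

Require Import Defs.
From mathcomp Require Import all_boot all_order all_algebra.
From mathcomp Require Import reals exp.
From mathcomp Require Import finfield zify ring lra.

Set Implicit Arguments.
Unset Strict Implicit.
Unset Printing Implicit Defensive.

Import Order.TTheory GRing.Theory Num.Theory.
Local Open Scope ring_scope.

(** * Supports, and dual words obtained from recovery sets *)

Definition dotv (F : finFieldType) (n : nat) (u v : 'rV[F]_n) : F :=
  \sum_j u 0 j * v 0 j.

Definition supp (F : finFieldType) (n : nat) (v : 'rV[F]_n) : {set 'I_n} :=
  [set j | v 0 j != 0].

Section Vectors.
Variables (F : finFieldType) (n : nat).
Implicit Types (u v w : 'rV[F]_n) (C : {vspace 'rV[F]_n}).

Lemma dotvD u v w : dotv u (v + w) = dotv u v + dotv u w.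
Proof. by rewrite -big_split; apply: eq_bigr => j _; rewrite mxE mulrDr. Qed.

Lemma dotvZ u a v : dotv u (a *: v) = a * dotv u v.
Proof. by rewrite mulr_sumr; apply: eq_bigr => j _; rewrite mxE mulrCA. Qed.

Lemma dotv0 u : dotv u 0 = 0.
Proof. by apply: big1 => j _; rewrite mxE mulr0. Qed.

Lemma dotv_sum (J : finType) u (f : J -> 'rV[F]_n) :
  dotv u (\sum_z f z) = \sum_z dotv u (f z).
Proof. exact: (big_morph _ (dotvD u) (dotv0 u)). Qed.

Lemma dotv_delta u j : dotv u (delta_mx 0 j) = u 0 j.
Proof.
rewrite /dotv (bigD1 j) //= mxE !eqxx mulr1 big1 ?addr0 // => i /negPf ij.
by rewrite mxE ij andbF mulr0.
Qed.

Lemma card_suppD u v : (#|supp (u + v)| <= #|supp u| + #|supp v|)%N.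
Proof.
apply: leq_trans (leq_card_setU _ _); apply: subset_leq_card.
apply/subsetP => j; rewrite !inE mxE -negb_and; apply: contra => /andP[/eqP-> /eqP->].
by rewrite addr0.
Qed.

Lemma card_suppZ a v : (#|supp (a *: v)| <= #|supp v|)%N.
Proof.
apply: subset_leq_card; apply/subsetP => j; rewrite !inE mxE.
by apply: contra => /eqP->; rewrite mulr0.
Qed.

Lemma card_supp_delta j : #|supp (delta_mx 0 j : 'rV[F]_n)| = 1%N.
Proof.
apply: etrans (cards1 j); apply: eq_card => i.
by rewrite !inE mxE eqxx /=; case: (i == j); rewrite ?oner_eq0 ?eqxx.
Qed.

Lemma card_supp0 : #|supp (0 : 'rV[F]_n)| = 0%N.
Proof. by apply: eq_card0 => i; rewrite !inE mxE eqxx. Qed.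

Lemma card_supp_sum (J : finType) (P : pred J) (f : J -> 'rV[F]_n) :
  (#|supp (\sum_(z | P z) f z)| <= \sum_(z | P z) #|supp (f z)|)%N.
Proof.
elim/big_rec2: _ => [|z m v _ IH]; first by rewrite card_supp0.
by apply: leq_trans (card_suppD _ _) _; rewrite leq_add2l.
Qed.

(* The i-th column of a generator matrix lies in the span of the columns
   indexed by [S :\ i], because every vector killed by the latter columns
   gives a codeword agreeing with 0 on [S :\ i]. *)
Lemma recovery_set_dual C i S : recovery_set C i S ->
  exists h : 'rV[F]_n,
    [/\ i \in supp h, supp h \subset S & forall c, c \in C -> dotv h c = 0].
Proof.
move=> [iS recS].
(* Otherwise [c] and the zero word would differ at [i] while having the same projection on
   [S :\ i]. *)
have vanish c : c \in C -> (forall j, j \in S :\ i -> c 0 j = 0) -> c 0 i = 0.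
  move=> cC c0; apply/eqP/negP => /negP nz.
  have := recS _ _ nz; move=> /setP/(_ (coord_proj (S :\ i) c)).
  rewrite !inE => /negP; apply; apply/andP; split; apply/imsetP.
    by exists c; rewrite // inE cC eqxx.
  exists 0; first by rewrite inE mem0v mxE eqxx.
  by apply/ffunP => -[j Sj]; rewrite !ffunE /= c0 // mxE.
pose k := \dim C; pose b := vbasis C.
(* [M] is a transposed generator matrix; the kernel of [B] consists of the messages whose codewords
   vanish on [S :\ i]. *)
pose M := \matrix_(j < n, t < k) b`_t 0 j.
pose B := \matrix_(j < n, t < k) (if j \in S :\ i then b`_t 0 j else 0).
have MC (v : 'cV[F]_k) : (M *m v)^T \in C.
  have -> : (M *m v)^T = \sum_(t < k) v t 0 *: b`_t.
    apply/rowP => j; rewrite mxE mxE summxE; apply: eq_bigr => t _.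
    by rewrite !mxE mulrC.
  apply: memv_suml => t _; apply: memvZ; apply: vbasis_mem.
  by rewrite mem_nth // size_tuple.
have /submxP[w rowE] : (row i M <= B)%MS.
  rewrite submxE; apply/eqP/rowP => t; set K := cokermx B.
  have BK : B *m col t K = 0 by rewrite colE mulmxA mulmx_coker mul0mx.
  suff e0 : (M *m col t K)^T 0 i = 0.
    by rewrite [RHS]mxE -[RHS]e0 !mxE; apply: eq_bigr => s _; rewrite !mxE.
  apply: vanish (MC _) _ => j jS; have /colP/(_ j) := BK.
  rewrite !mxE => Bj0; rewrite -[RHS]Bj0.
  by apply: eq_bigr => s _; rewrite !mxE jS.
pose h := \row_j (if j == i then 1 else if j \in S then - w 0 j else 0).
have hb t : (t < k)%N -> dotv h b`_t = 0.
  move=> tk; have /rowP/(_ (Ordinal tk)) := rowE; rewrite !mxE /= => e.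
  rewrite /dotv (bigD1 i) //= mxE eqxx mul1r e (bigD1 i) //= !mxE !inE eqxx /=.
  rewrite mulr0 add0r -big_split /= big1 // => j /negPf ji.
  rewrite !mxE !inE ji /=.
  by case: (j \in S); rewrite ?mulr0 ?mul0r ?addr0 // mulNr subrr.
exists h; split.
- by rewrite inE mxE eqxx oner_eq0.
- apply/subsetP => j; rewrite inE mxE; case: (eqVneq j i) => [-> //|_].
  by case: (j \in S); rewrite ?eqxx.
- move=> c cC; rewrite (coord_vbasis cC) dotv_sum big1 // => t _.
  by rewrite dotvZ hb ?mulr0.
Qed.

(* The [h (s x)] form a minimal cover of the coordinates by supports. *)
Lemma private_cover (h : 'I_n -> 'rV[F]_n) : (forall x, x \in supp (h x)) ->
  exists (l : nat) (s p : 'I_l -> 'I_n),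
    (forall x y, (p y \in supp (h (s x))) = (x == y)) /\
    (forall j, exists x, j \in supp (h (s x))).
Proof.
move=> hx; pose cov (L : {set 'I_n}) := [forall j, exists x in L, j \in supp (h x)].
have [|L /minsetP[/forallP covL minL] _] := @minset_exists _ cov setT.
  by apply/forallP => j; apply/existsP; exists j; rewrite inE hx.
have priv (x : 'I_#|L|) : exists q, forall y : 'I_#|L|,
    (q \in supp (h (enum_val y))) = (y == x).
  have xL := enum_valP x.
  (* By minimality, dropping the index leaves some [q] uncovered; as [L] covers [q], this coordinate
     is private to the dropped support. *)
  have : ~~ cov (L :\ enum_val x).
    apply/negP => /minL /(_ (subD1set _ _)) /setP /(_ (enum_val x)).
    by rewrite !inE eqxx xL.
  rewrite negb_forall => /existsP[q]; rewrite negb_exists => /forallP qN.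
  have N y : y != x -> q \notin supp (h (enum_val y)).
    move=> yx; have := qN (enum_val y); rewrite in_setD1 enum_valP andbT.
    by rewrite (inj_eq enum_val_inj) yx.
  exists q => y; case: (eqVneq y x) => [->|yx]; last by apply/negbTE/N.
  have /existsP[z /andP[zL qz]] := covL q.
  have [/eqP zx|zx] := boolP (enum_rank_in xL z == x).
    by rewrite -zx enum_rankK_in.
  by have := N _ zx; rewrite enum_rankK_in // qz.
have [p pP] := fin_all_exists priv.
exists #|L|, enum_val, p; split => [x y|j]; first exact: pP.
have /existsP[z /andP[zL jz]] := covL j.
by exists (enum_rank_in zL z); rewrite enum_rankK_in.
Qed.

End Vectors.

(** * Packing in the space cut out by the local parity checks *)

Section Packing.
Variables (F : finFieldType) (n : nat) (I : finType).
Variables (h : I -> 'rV[F]_n) (p : I -> 'I_n).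
Hypothesis pivots : forall x y, (p y \in supp (h x)) = (x == y).

Definition local_space := [set v : 'rV[F]_n | [forall x, dotv (h x) v == 0]].

Lemma local_spaceP v :
  reflect (forall x, dotv (h x) v = 0) (v \in local_space).
Proof. by rewrite inE; apply: (iffP forallP) => H x; apply/eqP/H. Qed.

Lemma pivot_neq0 x : h x 0 (p x) != 0.
Proof. by have := pivots x x; rewrite inE eqxx. Qed.

Lemma pivot_eq0 x y : x != y -> h x 0 (p y) = 0.
Proof.
by move=> /negPf xy; have := pivots x y; rewrite inE xy => /negbFE/eqP.
Qed.

(** The matrix of the [h x] at the pivots is diagonal and invertible. Hence pairing with [h x]
    recovers the coefficients of a combination of pivot unit vectors added to an element of
    [local_space], and all such sums are distinct. *)
Lemma card_local_space : (#|local_space| * #|F| ^ #|I| <= #|F| ^ n)%N.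
Proof.
pose g (z : 'rV[F]_n * {ffun I -> F}) := z.1 + \sum_x z.2 x *: delta_mx 0 (p x).
pose D := setX local_space [set: {ffun I -> F}].
have gE z x : z \in D -> dotv (h x) (g z) = z.2 x * h x 0 (p x).
  case: z => v f; rewrite in_setX => /andP[/local_spaceP v0 _].
  rewrite dotvD v0 add0r dotv_sum (bigD1 x) //= dotvZ dotv_delta.
  rewrite big1 ?addr0 // => y; rewrite eq_sym => xy.
  by rewrite dotvZ dotv_delta (pivot_eq0 xy) mulr0.
have inj_g : {in D &, injective g}.
  move=> z z' zD zD' e; have fE : z.2 = z'.2.
    apply/ffunP => x; apply: (mulIf (pivot_neq0 x)).
    by rewrite -!gE // e.
  move: e; rewrite /g fE => /addIr; move: z z' fE {zD zD'} => [? ?] [? ?] /= -> ->.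
  by [].
have -> : (#|local_space| * #|F| ^ #|I| = #|D|)%N by rewrite cardsX cardsT card_ffun.
have -> : (#|F| ^ n = #|{: 'rV[F]_n}|)%N by rewrite card_mx mul1n.
by rewrite -(card_in_imset inj_g) max_card.
Qed.

(* [local_vec j] is the unit vector at a non-pivot [j], corrected at the pivots
   so as to be orthogonal to every [h x]. *)
Definition local_vec j : 'rV[F]_n :=
  delta_mx 0 j - \sum_x (h x 0 j / h x 0 (p x)) *: delta_mx 0 (p x).

Lemma local_vecP j : local_vec j \in local_space.
Proof.
apply/local_spaceP => x; rewrite dotvD -scaleN1r dotvZ dotv_sum dotv_delta.
rewrite (bigD1 x) //= dotvZ dotv_delta divfK ?pivot_neq0 // big1 => [|y].
  by rewrite addr0 mulN1r subrr.
by rewrite eq_sym => xy; rewrite dotvZ dotv_delta (pivot_eq0 xy) mulr0.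
Qed.

Definition free_coords : {set 'I_n} :=
  [set j | (j \notin codom p) && (#|[set x | j \in supp (h x)]| == 1%N)].

Lemma card_supp_local_vec j : j \in free_coords -> (#|supp (local_vec j)| <= 2)%N.
Proof.
rewrite inE => /andP[_ /cards1P[x /setP hx]]; have h0 y : y != x -> h y 0 j = 0.
  by move=> /negPf yx; have := hx y; rewrite !inE yx => /negbFE/eqP.
rewrite /local_vec (bigD1 x) //= big1 ?addr0 => [|y /h0 ->]; last first.
  by rewrite mul0r scale0r.
apply: leq_trans (card_suppD _ _) _; rewrite card_supp_delta -scaleNr.
by apply: leq_trans (leq_add (leqnn _) (card_suppZ _ _)) _; rewrite card_supp_delta.
Qed.

(** Corrections sit at pivots only, so a combination of local vectors displays its coefficients at
    the free coordinates. *)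
Lemma local_vecE i j : i \in free_coords -> local_vec j 0 i = (i == j)%:R.
Proof.
rewrite inE => /andP[iN _]; rewrite mxE mxE eqxx mxE summxE big1 ?subr0 // => x _.
rewrite !mxE eqxx /=; case: eqP => [ip|_]; last by rewrite mulr0.
by rewrite ip codom_f in iN.
Qed.

(* Double counting of the incidences between coordinates and supports. *)
Lemma card_free_coords r : (forall x, #|supp (h x)| <= r.+1)%N ->
  (forall j, exists x, j \in supp (h x)) ->
  (n <= #|I| * r.+1 /\ 2 * n <= #|free_coords| + #|I| * r.+2)%N.
Proof.
move=> hr cov; pose mu j := #|[set x | j \in supp (h x)]|.
have sum_mu : (\sum_j mu j <= #|I| * r.+1)%N.
  have -> : (\sum_j mu j = \sum_x #|supp (h x)|)%N.
    transitivity (\sum_j \sum_x (j \in supp (h x)) : nat)%N.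
      by apply: eq_bigr => j _; rewrite /mu -sum1dep_card [LHS]big_mkcond.
    rewrite exchange_big; apply: eq_bigr => x _.
    by rewrite -sum1_card [RHS]big_mkcond.
  by rewrite -sum_nat_const; apply: leq_sum.
have mu_gt0 j : (0 < mu j)%N.
  by have [x jx] := cov j; apply/card_gt0P; exists x; rewrite inE.
split.
  apply: leq_trans sum_mu; rewrite -[leqLHS]card_ord -sum1_card.
  by apply: leq_sum => j _; apply: mu_gt0.
(* A coordinate lying in a single support is a pivot or free; any other has [mu j >= 2]. *)
have : (\sum_(j < n) 2 <= \sum_j mu j + \sum_j (j \in free_coords) +
         \sum_j (j \in codom p))%N.
  rewrite -!big_split /=; apply: leq_sum => j _; rewrite inE -/(mu j).
  by move: (mu_gt0 j); case: (j \in codom p); case: (mu j) => [|[|m]].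
rewrite sum_nat_const card_ord => le2n.
have -> : (#|free_coords| = \sum_j (j \in free_coords))%N.
  by rewrite -sum1_card [LHS]big_mkcond.
have cardp : (\sum_j (j \in codom p) <= #|I|)%N.
  rewrite -(size_codom p); apply: leq_trans (card_size _).
  by rewrite -sum1_card [leqRHS]big_mkcond.
have -> : (2 * n = n * 2)%N by rewrite mulnC.
apply: leq_trans le2n _; rewrite mulnS; lia.
Qed.

(* A Hamming bound in the coordinates of [local_vec], which at most doubles
   weights: up to [e] errors placed in disjoint sets of size [s], and [dl]
   coordinates left arbitrary. *)
Lemma local_packing (C : {vspace 'rV[F]_n}) (d e s dl : nat) :
  (forall c, c \in C -> c \in local_space) ->
  (forall c, c \in C -> c != 0 -> (d <= #|supp c|)%N) ->
  (e * s + dl <= #|free_coords|)%N -> (4 * e + 2 * dl < d)%N ->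
  ((s * #|F|.-1) ^ e * #|F| ^ dl * #|F| ^ (\dim C) <= #|local_space|)%N.
Proof.
move=> CV mind size_T ltd.
pose Z := (('I_e * 'I_s) + 'I_dl)%type.
have cardZ : (#|{: Z}| <= #|free_coords|)%N by rewrite card_sum card_prod !card_ord.
pose tau (z : Z) : 'I_n := enum_val (widen_ord cardZ (enum_rank z)).
have tauT z : tau z \in free_coords by apply: enum_valP.
have tau_inj : injective tau.
  by move=> z z' /enum_val_inj /(congr1 val) /= /val_inj /enum_rank_inj.
pose nz := {a : F | a != 0}.
(* An error pattern picks in each of the [e] blocks one position and a nonzero value there, and any
   values on the [dl] extra coordinates. *)
pose X := ({ffun 'I_e -> 'I_s * nz} * {ffun 'I_dl -> F})%type.
pose co (w : X) (z : Z) : F := match z with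
  | inl u => if u.2 == (w.1 u.1).1 then val (w.1 u.1).2 else 0
  | inr i => w.2 i end.
pose Y (w : X) := \sum_z co w z *: local_vec (tau z).
have YE w z : Y w 0 (tau z) = co w z.
  rewrite summxE (bigD1 z) //= mxE local_vecE // eqxx mulr1 big1 ?addr0 // => z'.
  by rewrite mxE local_vecE // inj_eq // eq_sym => /negPf ->; rewrite mulr0.
have co_inj w w' : co w =1 co w' -> w = w'.
  move=> e'; case: w w' e' => [f g] [f' g'] e'; congr pair; apply/ffunP => t.
    have := e' (inl (t, (f t).1)); rewrite /= eqxx; case: eqP => [e1 e2|_ e2].
      by case: (f t) (f' t) e1 e2 => [? ?] [? ?] /= -> /val_inj ->.
    by have := valP (f t).2; rewrite /= e2 eqxx.
  exact: (e' (inr t)).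
(* Two patterns differ in at most [2 * e + dl] slots, each contributing weight at most 2. *)
have wtY w w' : (#|supp (Y w - Y w')| < d)%N.
  apply: leq_ltn_trans ltd.
  pose A := [set inl (t, (w.1 t).1) | t : 'I_e] :|: [set inl (t, (w'.1 t).1) | t : 'I_e]
    :|: [set inr i | i : 'I_dl] : {set Z}.
  have cardA : (#|A| <= e + e + dl)%N.
    apply: leq_trans (leq_card_setU _ _) (leq_add _ _).
      apply: leq_trans (leq_card_setU _ _) (leq_add _ _);
      by apply: leq_trans (leq_imset_card _ _) _; rewrite cardT -cardE card_ord.
    by apply: leq_trans (leq_imset_card _ _) _; rewrite cardT -cardE card_ord.
  have -> : Y w - Y w' = \sum_(z in A) (co w z - co w' z) *: local_vec (tau z).
    rewrite -sumrB [RHS]big_mkcond; apply: eq_bigr => z _; rewrite -scalerBl.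
    case: ifP => // /negP zA; suff -> : co w z - co w' z = 0 by rewrite scale0r.
    case: z zA => [[t j]|i] zA /=; last first.
      by case: zA; rewrite !inE; apply/orP; right; apply: imset_f.
    case: eqP => [jt|_].
      case: zA; rewrite !inE; apply/orP; left; apply/orP; left.
      by apply/imsetP; exists t; rewrite ?jt.
    case: eqP => [jt|_]; last exact: subrr.
    case: zA; rewrite !inE; apply/orP; left; apply/orP; right.
    by apply/imsetP; exists t; rewrite ?jt.
  apply: leq_trans (card_supp_sum _ _) _.
  apply: (@leq_trans (\sum_(z in A) 2)%N).
    apply: leq_sum => z _; apply: leq_trans (card_suppZ _ _) _.
    exact: card_supp_local_vec.
  by rewrite sum_nat_const; lia.
have YV w : Y w \in local_space.
  apply/local_spaceP => x; rewrite dotv_sum big1 // => z _.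
  by have /local_spaceP H := local_vecP (tau z); rewrite dotvZ H mulr0.
pose D := setX [set: X] [set c | c \in C].
pose g (z : X * 'rV[F]_n) := Y z.1 + z.2.
(* A collision makes [Y w - Y w'] a codeword of weight below [d], hence zero; the pattern is then
   read off at the [tau z]. *)
have inj_g : {in D &, injective g}.
  move=> [w c] [w' c']; rewrite !in_setX !inE /= => cC cC' E.
  have E' : Y w - Y w' = c' - c.
    by rewrite -[Y w](addrK c) [_ + c]E -(addrA _ c') addrAC subrr add0r.
  have := wtY w w'; have := mind (c' - c) (memvB cC' cC); rewrite E'.
  have [/eqP|_ H] := eqVneq (c' - c) 0; last by rewrite ltnNge H.
  rewrite subr_eq0 => /eqP ec _ _; congr pair; last by rewrite ec.
  apply: co_inj => z; rewrite -!YE; move: E'; rewrite ec subrr => /eqP.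
  by rewrite subr_eq0 => /eqP ->.
have -> : ((s * #|F|.-1) ^ e * #|F| ^ dl * #|F| ^ (\dim C) = #|D|)%N.
  rewrite cardsX cardsT card_prod !card_ffun !card_ord card_prod card_ord.
  congr (_ * _)%N; last by rewrite cardsE -card_vspace.
  congr ((_ * _) ^ _ * _)%N; rewrite card_sig -(cardC1 (0 : F)).
  by apply: eq_card => a; rewrite !inE.
rewrite -(card_in_imset inj_g); apply: subset_leq_card.
apply/subsetP => v /imsetP[[w c]]; rewrite in_setX inE /= => cC ->.
apply/local_spaceP => x; rewrite /g dotvD.
have /local_spaceP -> := YV w; have := CV c; rewrite inE in cC.
by move=> /(_ cC) /local_spaceP ->; rewrite addr0.
Qed.

End Packing.

(** * Numerical consequences of optimality and of the length condition *)

Lemma optimal_redundancy n k d r (m := (n %/ r.+1)%N) :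
  (0 < r)%N -> (1 < d)%N -> (r.+1 %| n)%N ->
  d%:Z = n%:Z - k%:Z - Num.ceil (k%:Q / r%:Q) + 2 ->
  (n + (d - 2) %/ r.+1 <= k + m + (d - 2))%N.
Proof.
move=> r0 d1 dvd_r dE; have nE : n = (m * r.+1)%N by rewrite divnK.
have rQ : 0 < (r%:Q : rat) by rewrite ltr0n.
set t := Num.ceil _ in dE; have /andP[] := Num.Theory.ceil_itv (k%:Q / r%:Q : rat).
rewrite -/t ltr_pdivlMr // ler_pdivrMr // -!intrM ltr_int ler_int.
move=> lt_k le_k; set f := ((d - 2) %/ r.+1)%N.
have fE : (f * r.+1 <= d - 2)%N by apply: leq_divM.
(* If [f + t > m], then [k > (t - 1) * r] and [d - 2 >= f * (r + 1)] push [n = k + t + (d - 2)]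
   above [m * (r + 1)]. *)
suff : f%:Z + t <= m%:Z by lia.
rewrite leNgt; apply/negP => lt_m.
have /(_ (f%:Z + t - 1 - m%:Z)) : forall z : int, 0 <= z -> 0 <= z * r.+1%:Z.
  by move=> z z0; apply: mulr_ge0.
nia.
Qed.

(** Here [l <= m + u], so [T >= m * r - u * (r + 2)]. With [m >= u * (3 * r + 2)], the bound by
    [5 * T] reduces to [12 * r ^ 2 >= 12], tight at [r = 1]. *)
Lemma free_coords_count n k l m r u f T :
  (0 < r)%N -> n = (m * r.+1)%N -> (n <= k + m + u)%N -> (k + l <= n)%N ->
  (u * (3 * r + 2) + f + 1 <= m)%N -> (2 * n <= T + l * r.+2)%N ->
  (u + f + 1 <= T /\ n <= 5 * T)%N.
Proof.
move=> r0 nE nk kl um nT.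
have : (l * r.+2 <= (m + u) * r.+2)%N by rewrite leq_mul2r; lia.
have : (u <= u * r)%N by rewrite leq_pmulr.
have : (u * r <= u * r * r)%N by rewrite leq_pmulr.
have : ((u * (3 * r + 2) + f + 1) * r <= m * r)%N by rewrite leq_mul2r um orbT.
have : (f + 1 <= (f + 1) * r)%N by rewrite leq_pmulr.
split; first nia.
have : (m <= m * r)%N by rewrite leq_pmulr.
nia.
Qed.

(** * Bounds on the length *)

Lemma lrc_packing_bound (F : finFieldType) n k d r (C : {vspace 'rV[F]_n}) e dl :
  (0 < r)%N -> optimal_LRC C k d r -> length_condition n d r ->
  (0 < e)%N -> (dl <= 1)%N -> (4 * e + 2 * dl < d)%N ->
  ((n * #|F|) ^ e * #|F| ^ dl <= (40 * e) ^ e * #|F| ^ (d - 2))%N.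
Proof.
move=> r0 [[k0 dimC [_ mind]] loc dE] [dvd_r len] e0 dl1 ltd.
have mind0 c : c \in C -> c != 0 -> (d <= #|supp c|)%N.
  move=> cC c0; have := mind c 0 cC (mem0v _) c0.
  by congr (_ <= _)%N; apply: eq_card => i; rewrite !inE mxE.
have [S recS] := fin_all_exists loc.
have [h0 h0P] := fin_all_exists (fun i => recovery_set_dual (recS i).1).
have [|l [s0 [p [pivots cov]]]] := @private_cover _ _ h0.
  by move=> x; have [] := h0P x.
pose h x := h0 (s0 x); have hr x : (#|supp (h x)| <= r.+1)%N.
  have [_ sub _] := h0P (s0 x).
  by rewrite -(recS (s0 x)).2; apply: subset_leq_card.
have CV c : c \in C -> c \in local_space h.
  by move=> cC; apply/local_spaceP => x; have [_ _ ->] := h0P (s0 x).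
have [len_n le2n] := card_free_coords p hr cov.
have cardV := card_local_space pivots.
rewrite card_ord in le2n len_n cardV.
have q1 := finNzRing_gt1 F.
set q := #|F| in cardV q1 *.
set m := (n %/ r.+1)%N in len; have nE : n = (m * r.+1)%N by rewrite divnK.
set f := ((d - 2) %/ r.+1)%N in len; set u := (d - 2 - f)%N in len.
have fd : (f <= d - 2)%N by apply: leq_div.
have red : (n <= k + m + u)%N.
  have d1 : (1 < d)%N by lia.
  by have := optimal_redundancy r0 d1 dvd_r dE; rewrite -/m -/f /u; lia.
have pack s := local_packing pivots CV mind0 (e := s).
(* The packing bound with no errors only says that the code lies in the local space. *)
have kln : (k + l <= n)%N.
  have := pack 0%N 0%N 0%N; rewrite !muln0 => /(_ isT) H.
  have {}H := H (leq_ltn_trans (leq0n _) ltd).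
  rewrite -(leq_exp2l _ _ q1) expnD; apply: leq_trans cardV.
  by rewrite leq_mul2r -dimC; move: H; rewrite expn0 !mul1n => ->; rewrite orbT.
have ml : (m <= l)%N by move: len_n; rewrite nE leq_pmul2r.
set T := #|free_coords h p| in le2n pack.
have [ltT nT] := free_coords_count r0 nE red kln len le2n.
have eT : (e + 1 <= T)%N by rewrite /u in ltT; lia.
(* One free coordinate is set aside because [dl] may be 1; the others are cut into [e] blocks. *)
pose s := ((T - 1) %/ e)%N.
have s1 : (1 <= s)%N by rewrite divn_gt0 //; lia.
have sT : (T - 1 < (s + 1) * e)%N by rewrite addn1 ltn_ceil.
have se : (e * s <= T - 1)%N by rewrite mulnC leq_divM.
have step1 : ((s * q.-1) ^ e * q ^ dl <= q ^ (d - 2))%N.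
  have n_le : (n <= d - 2 + (k + l))%N by lia.
  rewrite -(@leq_pmul2r (q ^ (k + l))); last by rewrite expn_gt0 ltnW.
  rewrite -expnD; apply: leq_trans (leq_pexp2l (ltnW q1) n_le).
  apply: leq_trans cardV; rewrite expnD mulnA leq_mul2r -dimC pack ?orbT //.
  lia.
(* The constant is [40 = 5 * 4 * 2], from [n <= 5 * T], [T <= 4 * (e * s)] and
   [q <= 2 * (q - 1)]. *)
have step2 : (n * q <= 40 * e * (s * q.-1))%N.
  have es : (e <= e * s)%N by rewrite leq_pmulr.
  have T1 : (T <= 4 * (e * s))%N by move: sT; clear -es; rewrite mulnDl mulnC; lia.
  have -> : (40 * e * (s * q.-1) = 5 * (4 * (e * s)) * (2 * q.-1))%N by ring.
  apply: leq_mul; last by clear -q1; lia.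
  by apply: leq_trans nT _; rewrite leq_mul2l T1 orbT.
apply: leq_trans (_ : (40 * e * (s * q.-1)) ^ e * q ^ dl <= _)%N.
  by rewrite leq_mul2r leq_exp2r // step2 orbT.
by rewrite expnMn -mulnA leq_mul2l step1 orbT.
Qed.

Lemma lrc_length_powR (R : realType) (F : finFieldType) n k d r
    (C : {vspace 'rV[F]_n}) e dl :
  (0 < r)%N -> optimal_LRC C k d r -> length_condition n d r ->
  (0 < e)%N -> (dl <= 1)%N -> (4 * e + 2 * dl < d)%N ->
  n%:R <= 40 * e%:R * #|F|%:R `^ ((d%:R - 2 - dl%:R) / e%:R - 1) :> R.
Proof.
move=> r0 opt len e0 dl1 ltd.
have := lrc_packing_bound r0 opt len e0 dl1 ltd.
have := finNzRing_gt1 F; set q := #|F| => q1 bnd.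
have q0 : (0 < q)%N := ltnW q1; have Q0 : 0 < q%:R :> R by rewrite ltr0n.
have e0R : 0 < e%:R :> R by rewrite ltr0n.
have -> : d%:R - 2 - dl%:R = (d - 2 - dl)%:R :> R by rewrite !natrB //; lia.
have bnd' : ((n * q) ^ e <= (40 * e) ^ e * q ^ (d - 2 - dl))%N.
  rewrite -(@leq_pmul2r (q ^ dl)) ?expn_gt0 ?q0 // -mulnA -expnD subnK //; lia.
rewrite powRB; last by apply/implyP => _; rewrite gt_eqF.
rewrite powRr1 ?(ltW Q0) // mulrA ler_pdivlMr //.
have rhs0 : 0 <= 40 * e%:R * q%:R `^ ((d - 2 - dl)%:R / e%:R) :> R.
  by rewrite !mulr_ge0 ?powR_ge0.
rewrite -(@ler_pXn2r _ e) // ?nnegrE ?mulr_ge0 //.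
rewrite [leRHS]exprMn -[X in _ <= _ * X]powR_mulrn ?powR_ge0 // -powRrM.
rewrite divfK ?gt_eqF // powR_mulrn //.
by rewrite -!natrM -!natrX -natrM ler_nat.
Qed.

(** Take [e = (d - a) / 4], the largest value with [4 * e < d]. If [a > 2] there is room for one
    arbitrary coordinate. The factor [40 * e = 10 * (d - a)] is at most [10 * d]. *)
Lemma lrc_length_mod4 (R : realType) (F : finFieldType) n k d r
    (C : {vspace 'rV[F]_n}) a :
  (0 < r)%N -> optimal_LRC C k d r -> length_condition n d r ->
  (5 <= d)%N -> a \in [:: 1; 2; 3; 4]%N -> d = a %[mod 4] ->
  n%:R <= 10 * d%:R *
    #|F|%:R `^ (4 * (d%:R - (2 + (2 < a)%N)%:R) / (d%:R - a%:R) - 1) :> R.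
Proof.
move=> r0 opt len d5 aP da.
have [a1 a4] : (0 < a /\ a <= 4)%N by move: aP; rewrite !inE; lia.
have [e dE] : exists e, (d = 4 * e + a)%N.
  by exists ((d - a) %/ 4)%N; move/eqP: da => da; lia.
have e0 : (0 < e)%N by lia.
have ltd : (4 * e + 2 * (2 < a) < d)%N by lia.
have := lrc_length_powR R r0 opt len e0 (leq_b1 _) ltd.
have eR : e%:R != 0 :> R by rewrite pnatr_eq0 -lt0n.
have -> : 4 * (d%:R - (2 + (2 < a)%N)%:R) / (d%:R - a%:R) =
          (d%:R - 2 - (2 < a)%:R) / e%:R :> R.
  have -> : d%:R - a%:R = 4 * e%:R :> R by rewrite dE natrD natrM; ring.
  by rewrite natrD; field.
move=> /le_trans; apply; rewrite ler_wpM2r ?powR_ge0 //.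
by rewrite -!natrM ler_nat; lia.
Qed.

Theorem theorem3p2 (R : realType) :
  (exists2 K : R, 0 < K &
    forall (F : finFieldType) (n k d r : nat) (C : {vspace 'rV[F]_n}) (a : nat),
      (1 <= r)%N -> optimal_LRC C k d r -> length_condition n d r ->
      (5 <= d)%N -> a \in [:: 1; 2; 3; 4]%N -> d = a %[mod 4] ->
      (a \in [:: 1; 2]%N ->
         n%:R <= K * d%:R *
           #|F|%:R `^ (4 * (d%:R - 2) / (d%:R - a%:R) - 1)) /\
      (a \in [:: 3; 4]%N ->
         n%:R <= K * d%:R *
           #|F|%:R `^ (4 * (d%:R - 3) / (d%:R - a%:R) - 1))) /\
  (exists2 K : R, 0 < K &
    forall (F : finFieldType) (n k d r : nat) (C : {vspace 'rV[F]_n}),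
      (1 <= r)%N -> optimal_LRC C k d r -> length_condition n d r ->
      (5 <= d)%N ->
      n%:R <= K * (d%:R * #|F|%:R `^ (3 + 4 / (d%:R - 4)))) /\
  (exists2 K : R, 0 < K &
    forall (F : finFieldType) (n k d r : nat) (C : {vspace 'rV[F]_n}),
      (1 <= r)%N -> optimal_LRC C k d r -> length_condition n d r ->
      (d = 5%N -> n%:R <= K * #|F|%:R ^+ 2) /\
      (d = 6%N -> n%:R <= K * #|F|%:R ^+ 3) /\
      (d = 7%N -> n%:R <= K * #|F|%:R ^+ 3) /\
      (d = 8%N -> n%:R <= K * #|F|%:R ^+ 4) /\
      (d = 9%N -> n%:R <= K * #|F|%:R `^ (5 / 2)) /\
      (d = 10%N -> n%:R <= K * #|F|%:R ^+ 3)).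
Proof.
split; last split.
- exists 10 => // F n k d r C a r1 opt len d5 aP da.
  have := lrc_length_mod4 R r1 opt len d5 aP da.
  by move=> H; split; rewrite !inE => /orP[] /eqP aE; move: H; rewrite aE.
- exists 10 => // F n k d r C r1 opt len d5.
  pose a := ((d - 1) %% 4 + 1)%N.
  have aP : a \in [:: 1; 2; 3; 4]%N by rewrite !inE /a; lia.
  have da : d = a %[mod 4] by rewrite /a; lia.
  have := lrc_length_mod4 R r1 opt len d5 aP da; rewrite mulrA => /le_trans.
  apply; rewrite ler_wpM2l ?mulr_ge0 // ler_powR.
    by [].
    by rewrite ler1n ltnW // finNzRing_gt1.
  have a_lt_d : (a < d)%N by rewrite /a; lia.
  have dR : 5 <= d%:R :> R by rewrite ler_nat.
  have adR : a%:R < d%:R :> R by rewrite ltr_nat.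
  (* The exponents agree when [a = 4]; for smaller [a] the one from the residue class is smaller. *)
  rewrite lerBlDr ler_pdivrMr ?subr_gt0 //.
  pose x : R := d%:R; rewrite -/x in dR adR *.
  have x4 : 0 < x - 4 by lra.
  have d4 : 0 < (x - 4)^-1 by rewrite invr_gt0.
  have d4K : (x - 4) * (x - 4)^-1 = 1 by rewrite divff // gt_eqF.
  move: aP adR; rewrite !inE => /or4P[] /eqP -> ? /=; rewrite ?natrD; nra.
- exists 80 => // F n k d r C r1 opt len.
  (* For [d <= 10] at most two errors are used, so [40 * e <= 80]. *)
  have bnd e dl x : (0 < e <= 2)%N -> (dl <= 1)%N -> (4 * e + 2 * dl < d)%N ->
      (d%:R - 2 - dl%:R) / e%:R - 1 = x -> n%:R <= 80 * #|F|%:R `^ x :> R.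
    move=> /andP[e0 e2] dl1 ltd <-.
    apply: le_trans (lrc_length_powR R r1 opt len e0 dl1 ltd) _.
    by rewrite ler_wpM2r ?powR_ge0 // -natrM ler_nat; lia.
  do 5?split; move=> dE; rewrite dE in bnd; rewrite -?powR_mulrn //.
  + by apply: (bnd 1%N 0%N) => //; field.
  + by apply: (bnd 1%N 0%N) => //; field.
  + by apply: (bnd 1%N 1%N) => //; field.
  + by apply: (bnd 1%N 1%N) => //; field.
  + by apply: (bnd 2%N 0%N) => //; field.
  + by apply: (bnd 2%N 0%N) => //; field.
Qed.
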